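(* Let $\mathbb{K}\in\{\mathbb{R},\mathbb{C},\mathbb{H}\}$ and let $m,n\ge 1$. There exist left and right general-diagonal scale functions $\mathcal{D}^L_U:\mathbb{K}^{m\times n}\to\mathbb{R}_+^{m\times m}$ and $\mathcal{D}^R_U:\mathbb{K}^{m\times n}\to\mathbb{R}_+^{n\times n}$ (defined on all $m\times n$ matrices, including those with zero entries) such that the operator $A\mapsto A^{-U}$ defined by $$A^{-U} := \mathcal{D}^R_U[A]\cdot\bigl(\mathcal{D}^L_U[A]\cdot A\cdot \mathcal{D}^R_U[A]\bigr)^{\dagger}\cdot \mathcal{D}^L_U[A]$$ satisfies, for every $A\in\mathbb{K}^{m\times n}$ and all nonsingular diagonal matrices $D\in\mathbb{K}^{m\times m}$ and $E\in\mathbb{K}^{n\times n}$: 1. $A\,A^{-U}A = A$; 2. $A^{-U}A\,A^{-U} = A^{-U}$; 3. $(DAE)^{-U} = E^{-1}A^{-U}D^{-1}$; 4. $\operatorname{rank}[A^{-U}] = \operatorname{rank}[A]$.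
   Context: $\mathbb{H}$ denotes the quaternions. $X^{\dagger}$ denotes the Moore-Penrose pseudoinverse of $X$. A positive diagonal matrix is a diagonal matrix with strictly positive real diagonal entries; a unitary diagonal matrix is a diagonal matrix over $\mathbb{K}$ whose diagonal entries have absolute value $1$. Definition (general-diagonal scale functions). Functions $\mathcal{D}^L_U$, $\mathcal{D}^R_U$ assigning to each $m\times n$ matrix $A$ a positive diagonal matrix $\mathcal{D}^L_U[A]\in\mathbb{R}_+^{m\times m}$ and a positive diagonal matrix $\mathcal{D}^R_U[A]\in\mathbb{R}_+^{n\times n}$ are called left and right general-diagonal scale functions if they jointly satisfy, for all $A$, all conformant positive diagonal matrices $D_+,E_+$, all conformant unitary diagonal matrices $D_u,D_v$, and all conformant permutation matrices $P,Q$: (i) $\mathcal{D}^L_U[D_+AE_+]\cdot(D_+AE_+)\cdot\mathcal{D}^R_U[D_+AE_+]=\mathcal{D}^L_U[A]\cdot A\cdot\mathcal{D}^R_U[A]$; (ii) $\mathcal{D}^L_U[PAQ]\cdot(PAQ)\cdot\mathcal{D}^R_U[PAQ]=P\cdot\{\mathcal{D}^L_U[A]\cdot A\cdot\mathcal{D}^R_U[A]\}\cdot Q$; (iii) $\mathcal{D}^L_U[D_uAD_v]=\mathcal{D}^L_U[A]$; (iv) $\mathcal{D}^R_U[D_uAD_v]=\mathcal{D}^R_U[A]$. *)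

(* Defs.v *)
From HB Require Import structures.
From mathcomp Require Import all_boot all_order all_algebra all_fingroup.
From mathcomp Require Import ring.
From mathcomp Require Import boolp classical_sets reals.
From mathcomp Require Import complex.

Set Implicit Arguments.
Unset Strict Implicit.
Unset Printing Implicit Defensive.

Import Order.TTheory GRing.Theory Num.Theory.

Local Open Scope ring_scope.

(* Quaternion a b c d is a + b i + c j + d k. *)
Record quaternion (R : Type) :=
  Quaternion { quat_r : R; quat_i : R; quat_j : R; quat_k : R }.

Definition quat_tuple (R : Type) (x : quaternion R) : R * R * R * R :=
  (quat_r x, quat_i x, quat_j x, quat_k x).

Definition tuple_quat (R : Type) (t : R * R * R * R) : quaternion R :=
  let: (a, b, c, d) := t in Quaternion a b c d.

Lemma quat_tupleK (R : Type) : cancel (@quat_tuple R) (@tuple_quat R).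
Proof. by case. Qed.

HB.instance Definition _ (R : eqType) :=
  Equality.copy (quaternion R) (can_type (@quat_tupleK R)).
HB.instance Definition _ (R : choiceType) :=
  Choice.copy (quaternion R) (can_type (@quat_tupleK R)).

Section QuaternionRing.
Variable R : realType.
Local Notation H := (quaternion R).

Definition quat_zero : H := Quaternion 0 0 0 0.

Definition quat_one : H := Quaternion 1 0 0 0.

Definition quat_opp (x : H) : H :=
  let: Quaternion a b c d := x in Quaternion (- a) (- b) (- c) (- d).

Definition quat_add (x y : H) : H :=
  let: Quaternion a b c d := x in let: Quaternion a' b' c' d' := y in
  Quaternion (a + a') (b + b') (c + c') (d + d').

Definition quat_mul (x y : H) : H :=
  let: Quaternion a b c d := x in let: Quaternion a' b' c' d' := y in
  Quaternion (a * a' - b * b' - c * c' - d * d')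
             (a * b' + b * a' + c * d' - d * c')
             (a * c' - b * d' + c * a' + d * b')
             (a * d' + b * c' - c * b' + d * a').

Definition quat_normsq (x : H) : R :=
  let: Quaternion a b c d := x in a ^+ 2 + b ^+ 2 + c ^+ 2 + d ^+ 2.

Definition quat_conj (x : H) : H :=
  let: Quaternion a b c d := x in Quaternion a (- b) (- c) (- d).

Definition quat_inv (x : H) : H :=
  let: Quaternion a b c d := quat_conj x in
  let N := quat_normsq x in Quaternion (a / N) (b / N) (c / N) (d / N).

Fact quat_addA : associative quat_add.
Proof.
by move=> [a b c d] [a' b' c' d'] [? ? ? ?] /=; congr Quaternion; ring.
Qed.

Fact quat_addC : commutative quat_add.
Proof. by move=> [a b c d] [a' b' c' d'] /=; congr Quaternion; ring. Qed.

Fact quat_add0 : left_id quat_zero quat_add.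
Proof. by move=> [a b c d] /=; congr Quaternion; ring. Qed.

Fact quat_addN : left_inverse quat_zero quat_opp quat_add.
Proof. by move=> [a b c d] /=; congr Quaternion; ring. Qed.

HB.instance Definition _ := GRing.isZmodule.Build H
  quat_addA quat_addC quat_add0 quat_addN.

Fact quat_mulA : associative quat_mul.
Proof.
by move=> [a b c d] [a' b' c' d'] [? ? ? ?] /=; congr Quaternion; ring.
Qed.

Fact quat_mul1l : left_id quat_one quat_mul.
Proof. by move=> [a b c d] /=; congr Quaternion; ring. Qed.

Fact quat_mul1r : right_id quat_one quat_mul.
Proof. by move=> [a b c d] /=; congr Quaternion; ring. Qed.

Fact quat_mulDl : left_distributive quat_mul +%R.
Proof.
by move=> [a b c d] [a' b' c' d'] [? ? ? ?] /=; congr Quaternion; ring.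
Qed.

Fact quat_mulDr : right_distributive quat_mul +%R.
Proof.
by move=> [a b c d] [a' b' c' d'] [? ? ? ?] /=; congr Quaternion; ring.
Qed.

Fact quat_one_neq0 : quat_one != 0 :> H.
Proof. by apply/eqP => -[] /eqP; rewrite oner_eq0. Qed.

HB.instance Definition _ := GRing.Zmodule_isNzRing.Build H
  quat_mulA quat_mul1l quat_mul1r quat_mulDl quat_mulDr quat_one_neq0.

Fact quat_normsq_eq0 (x : H) : (quat_normsq x == 0) = (x == 0).
Proof.
apply/eqP/eqP => [|->]; last by rewrite /= expr0n /= !addr0.
case: x => [a b c d] /= /eqP.
rewrite !paddr_eq0 ?addr_ge0 ?sqr_ge0 // !sqrf_eq0.
by case/andP=> /andP[/andP[/eqP-> /eqP->] /eqP->] /eqP->.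
Qed.

Definition quat_unit : pred H := [pred x | x != 0].

Fact quat_mulVq : {in quat_unit, left_inverse 1 quat_inv *%R}.
Proof.
move=> x; rewrite inE -quat_normsq_eq0 => N0.
change (quat_mul (quat_inv x) x = quat_one); move: N0; case: x => a b c d /= N0.
by congr Quaternion; field.
Qed.

Fact quat_mulqV : {in quat_unit, right_inverse 1 quat_inv *%R}.
Proof.
move=> x; rewrite inE -quat_normsq_eq0 => N0.
change (quat_mul x (quat_inv x) = quat_one); move: N0; case: x => a b c d /= N0.
by congr Quaternion; field.
Qed.

Fact quat_unitP (x y : H) : y * x = 1 /\ x * y = 1 -> quat_unit x.
Proof.
case=> yx1 _; apply/eqP => x0; move: yx1; rewrite x0 mulr0 => /esym/eqP.
by rewrite oner_eq0.
Qed.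

Fact quat_invr_out : {in [predC quat_unit], quat_inv =1 id}.
Proof.
move=> x; rewrite !inE negbK => /eqP->.
change (quat_inv quat_zero = quat_zero).
by rewrite /quat_inv /= oppr0 !mul0r.
Qed.

HB.instance Definition _ := GRing.NzRing_hasMulInverse.Build H
  quat_mulVq quat_mulqV quat_unitP quat_invr_out.

End QuaternionRing.

Variant scalars := Reals | Complexes | Quaternions.

Definition carrier (R : realType) (k : scalars) : unitRingType :=
  match k with
  | Reals => R
  | Complexes => R[i]
  | Quaternions => quaternion R
  end.

Definition ofreal (R : realType) (k : scalars) : R -> carrier R k :=
  match k with
  | Reals => fun x => x
  | Complexes => fun x => (x%:C)%C
  | Quaternions => fun x => Quaternion x 0 0 0
  end.

Definition sconj (R : realType) (k : scalars) : carrier R k -> carrier R k :=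
  match k with
  | Reals => fun x => x
  | Complexes => @conjc R
  | Quaternions => @quat_conj R
  end.

Definition sabs (R : realType) (k : scalars) : carrier R k -> R :=
  match k with
  | Reals => fun x => `|x|
  | Complexes => @ComplexField.Normc.normc R
  | Quaternions => fun x => Num.sqrt (quat_normsq x)
  end.

Definition ofreal_mx (R : realType) (k : scalars) (m n : nat)
  (A : 'M[R]_(m, n)) : 'M[carrier R k]_(m, n) := map_mx (@ofreal R k) A.

Definition conjT (R : realType) (k : scalars) (m n : nat)
  (A : 'M[carrier R k]_(m, n)) : 'M[carrier R k]_(n, m) :=
  map_mx (@sconj R k) A^T.

Definition is_pinv (R : realType) (k : scalars) (m n : nat)
    (A : 'M[carrier R k]_(m, n)) (X : 'M[carrier R k]_(n, m)) : Prop :=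
  [/\ A *m X *m A = A, X *m A *m X = X,
      conjT (A *m X) = A *m X & conjT (X *m A) = X *m A].

(* The default value 0 is never used: the four Penrose equations have exactly *)
(* one solution over each of the three scalar rings.                          *)
Definition pinv (R : realType) (k : scalars) (m n : nat)
    (A : 'M[carrier R k]_(m, n)) : 'M[carrier R k]_(n, m) :=
  xget 0 [set X | is_pinv A X]%classic.

(* The rank is the dimension of the right span of the columns, i.e. the       *)
(* largest number of right-linearly independent columns; A *m v is the        *)
(* combination of the columns of A with the entries of v as right             *)
(* coefficients. The library's \rank needs a commutative field, where both    *)
(* notions agree (col_rank_mxrank).                                           *)
Definition col_indep (K : nzRingType) (m n : nat) (A : 'M[K]_(m, n))
    (J : {set 'I_n}) : Prop :=
  forall v : 'cV[K]_n,
    (forall j, j \notin J -> v j 0 = 0) -> A *m v = 0 -> v = 0.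

Definition col_rank (K : nzRingType) (m n : nat) (A : 'M[K]_(m, n)) : nat :=
  \max_(J : {set 'I_n} | `[< col_indep A J >]) #|J|.

Definition is_pos_diag (R : realType) (n : nat) (D : 'M[R]_n) : Prop :=
  is_diag_mx D /\ forall i, 0 < D i i.

Definition is_unitary_diag (R : realType) (k : scalars) (n : nat)
    (D : 'M[carrier R k]_n) : Prop :=
  is_diag_mx D /\ forall i, sabs (D i i) = 1.

Definition is_inverse_mx (K : nzRingType) (n : nat) (D D' : 'M[K]_n) : Prop :=
  D *m D' = 1%:M /\ D' *m D = 1%:M.

Definition scaled (R : realType) (k : scalars) (m n : nat)
    (DL : 'M[carrier R k]_(m, n) -> 'M[R]_m)
    (DR : 'M[carrier R k]_(m, n) -> 'M[R]_n)
    (A : 'M[carrier R k]_(m, n)) : 'M[carrier R k]_(m, n) :=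
  ofreal_mx k (DL A) *m A *m ofreal_mx k (DR A).

Record general_diagonal_scale (R : realType) (k : scalars) (m n : nat)
    (DL : 'M[carrier R k]_(m, n) -> 'M[R]_m)
    (DR : 'M[carrier R k]_(m, n) -> 'M[R]_n) : Prop := {
  scale_posL : forall A, is_pos_diag (DL A);
  scale_posR : forall A, is_pos_diag (DR A);
  scale_pos : forall A (Dp : 'M[R]_m) (Ep : 'M[R]_n),
    is_pos_diag Dp -> is_pos_diag Ep ->
    scaled DL DR (ofreal_mx k Dp *m A *m ofreal_mx k Ep) = scaled DL DR A;
  scale_perm : forall A (s : 'S_m) (t : 'S_n),
    scaled DL DR (perm_mx s *m A *m perm_mx t)
      = perm_mx s *m scaled DL DR A *m perm_mx t;
  scale_unitL : forall A (Du : 'M[carrier R k]_m) (Dv : 'M[carrier R k]_n),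
    is_unitary_diag Du -> is_unitary_diag Dv -> DL (Du *m A *m Dv) = DL A;
  scale_unitR : forall A (Du : 'M[carrier R k]_m) (Dv : 'M[carrier R k]_n),
    is_unitary_diag Du -> is_unitary_diag Dv -> DR (Du *m A *m Dv) = DR A
}.

Definition Uinv (R : realType) (k : scalars) (m n : nat)
    (DL : 'M[carrier R k]_(m, n) -> 'M[R]_m)
    (DR : 'M[carrier R k]_(m, n) -> 'M[R]_n)
    (A : 'M[carrier R k]_(m, n)) : 'M[carrier R k]_(n, m) :=
  ofreal_mx k (DR A) *m pinv (scaled DL DR A) *m ofreal_mx k (DL A).

Lemma conjTM (R : realType) (k : scalars) (m n p : nat)
    (A : 'M[carrier R k]_(m, n)) (B : 'M[carrier R k]_(n, p)) :
  conjT (A *m B) = conjT B *m conjT A.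
Proof.
have conjD (x y : carrier R k) : sconj (x + y) = sconj x + sconj y.
  case: k x y {A B} => //= x y; first exact: rmorphD.
  by case: x y => [a b c d] [a' b' c' d']; congr Quaternion => /=; ring.
have conj0 : sconj (0 : carrier R k) = 0.
  by have := conjD 0 0; rewrite addr0 => /eqP; rewrite eq_sym -subr_eq0 addrK => /eqP.
have conjM (x y : carrier R k) : sconj (x * y) = sconj y * sconj x.
  case: k x y {A B conjD conj0} => /= x y; first exact: mulrC.
    by rewrite mulrC rmorphM.
  by case: x y => [a b c d] [a' b' c' d']; congr Quaternion => /=; ring.
apply/matrixP => i j; rewrite !mxE (big_morph _ conjD conj0).
by apply: eq_bigr => l _; rewrite !mxE conjM.
Qed.

Lemma is_pinv_uniq (R : realType) (k : scalars) (m n : nat)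
    (A : 'M[carrier R k]_(m, n)) (X Y : 'M[carrier R k]_(n, m)) :
  is_pinv A X -> is_pinv A Y -> X = Y.
Proof.
case=> [AXA XAX AXh XAh] [AYA YAY AYh YAh].
have AXY : A *m X = A *m Y.
  by rewrite -AXh -[in LHS]AYA -(mulmxA (A *m Y)) conjTM AXh AYh !mulmxA AXA.
have XYA : X *m A = Y *m A.
  rewrite -YAh -[in RHS]AXA -(mulmxA A X) (mulmxA Y) conjTM XAh YAh.
  by rewrite -!mulmxA (mulmxA A Y) AYA.
by rewrite -XAX -mulmxA AXY mulmxA XYA YAY.
Qed.

Lemma pinvE (R : realType) (k : scalars) (m n : nat)
    (A : 'M[carrier R k]_(m, n)) (X : 'M[carrier R k]_(n, m)) :
  is_pinv A X -> pinv A = X.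
Proof. by move=> AX; apply: xget_unique => // Y /is_pinv_uniq; exact. Qed.

Lemma col_rank_mxrank (F : fieldType) (m n : nat) (A : 'M[F]_(m, n)) :
  col_rank A = \rank A.
Proof.
have mulmx_cols (J : {set 'I_n}) (v : 'cV[F]_n) :
    (forall j, j \notin J -> v j 0 = 0) ->
    A *m v = colsub (@enum_val _ (mem J)) A *m rowsub (@enum_val _ (mem J)) v.
  move=> v0; apply/matrixP => i l; rewrite !mxE (bigID (mem J)) /=.
  rewrite [X in _ + X]big1 ?addr0 => [|j jJ]; last first.
    by rewrite ord1 v0 // mulr0.
  rewrite big_enum_val; apply: eq_bigr => j _.
  by rewrite !mxE.
apply/eqP; rewrite eqn_leq; apply/andP; split.
  apply/bigmax_leqP => J /asboolP Jfree.
  set B := colsub (@enum_val _ (mem J)) A.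
  have rB : row_free B^T.
    apply/inj_row_free => w wB0.
    pose v : 'cV[F]_n := \col_j \sum_(l < #|J| | enum_val l == j) w 0 l.
    have vE l : v (enum_val l) 0 = w 0 l.
      rewrite mxE (big_pred1 l) // => l'.
      by rewrite (inj_eq enum_val_inj).
    have v0 j : j \notin J -> v j 0 = 0.
      move=> jJ; rewrite mxE big1 // => l /eqP lj.
      by move: jJ; rewrite -lj enum_valP.
    have rv : rowsub (@enum_val _ (mem J)) v = w^T.
      by apply/matrixP => l z; rewrite ord1 [LHS]mxE vE mxE.
    have : v = 0.
      apply: Jfree => //; rewrite (mulmx_cols J) // rv -/B.
      by rewrite -[B]trmxK -trmx_mul wB0 trmx0.
    by move=> v00; apply/rowP => l; rewrite -vE v00 !mxE.
  rewrite -mxrank_tr -(eqP rB) /B.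
  have -> : (colsub (@enum_val _ (mem J)) A)^T
            = rowsub (@enum_val _ (mem J)) A^T.
    by apply/matrixP => i j; rewrite !mxE.
  exact/mxrankS/rowsub_sub.
pose f := maxrankfun A^T.
have ffree : row_free (rowsub f A^T) := maxrowsub_free A^T.
have f_inj : injective f := @maxrankfun_inj _ _ _ A^T.
pose J := [set f l | l : 'I_(\rank A^T)].
rewrite -[X in (X <= _)%N]mxrank_tr.
have <- : #|J| = \rank A^T by rewrite card_imset // card_ord.
rewrite /col_rank; apply: (leq_bigmax_cond (F := fun B : {set 'I_n} => #|B|)).
apply/asboolP => v v0 Av0.
pose u : 'rV[F]_(\rank A^T) := \row_l v (f l) 0.
have u0 : u = 0.
  apply: (row_free_inj ffree); rewrite mul0mx; apply/rowP => i.
  have := congr1 (fun M : 'cV_m => M i 0) Av0; rewrite !mxE => Avi.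
  rewrite -[RHS]Avi {Avi}.
  rewrite [RHS](bigID (mem J)) /= [X in _ = _ + X]big1 ?addr0; last first.
    by move=> j jJ; rewrite v0 // mulr0.
  rewrite big_imset => [|l l' _ _ /f_inj//].
  by apply: eq_big => // l _; rewrite !mxE mulrC.
apply/colP => j; rewrite mxE; have [/imsetP[l _ ->]|/v0//] := boolP (j \in J).
by have := congr1 (fun M : 'rV_(_) => M 0 l) u0; rewrite !mxE.
Qed.

(* Main.v *)
Require Import Defs.
From HB Require Import structures.
From mathcomp Require Import all_boot all_order all_algebra all_fingroup.
From mathcomp Require Import ring.
From mathcomp Require Import boolp classical_sets reals sequences exp.
From mathcomp Require Import complex.

Set Implicit Arguments.
Unset Strict Implicit.
Unset Printing Implicit Defensive.

Import Order.TTheory GRing.Theory Num.Theory.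

Local Open Scope ring_scope.

(* The rows and columns of |A| are rescaled so that the logarithms of the     *)
(* nonzero entries sum to zero in every row and column. In the unknown        *)
(* logarithmic scales a_i, b_j this is the normal equation of a least-squares *)
(* problem, hence solvable, and a_i + b_j is determined on the support of A;  *)
(* this uniqueness gives (i) and (ii). The individual scales are not unique,  *)
(* so they are chosen as a function of |A|, which gives (iii) and (iv).       *)
(* If A' = D A E has scaled form S' = U S V with U, V diagonal, uniqueness    *)
(* gives |U| S |V| = S. Then U^* U commutes with the projection S S^+ (and V  *)
(* similarly with S^+ S), whence S'^+ = V^-1 S^+ U^-1, which is statement 3.  *)
(* The pseudoinverse exists over the noncommutative scalars by Greville's     *)
(* column recursion, since c^* c is real, hence central, for a column c.      *)

(** With P, Q the scales of A and S = P A Q, the operator is A^{-U} = Q S^+ P. As P and Q are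
    invertible, the first two Penrose equations for S become statements 1 and 2 ([Uinv_ginverse]);
    statement 4 follows from these because rank does not grow under products
    ([col_rank_reflexive_ginv]). The choice of scales matters for the axioms and for statement 3.
    There [balanced_exists] and [balanced_unique] combine in [weight_rescale]: the factor applied to
    a nonzero entry absorbs every rescaling and follows every permutation. Pseudoinverses do not
    respect diagonal scalings in general; [is_pinv_similar] gives a condition under which they do,
    and [Uinv_diag] verifies it from the equality of weights. *)

Section Scalars.
Variables (R : realType) (k : scalars).
Local Notation K := (carrier R k).
Implicit Types (r s : R) (x y : K).

Fact ofreal_is_additive : zmod_morphism (@ofreal R k).
Proof.
case: k => //= r s; first exact: (rmorphB (real_complex R)).
by congr Quaternion; rewrite ?oppr0 ?addr0.
Qed.

Fact ofreal_is_monoid_morphism : monoid_morphism (@ofreal R k).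
Proof.
case: k => //=; split=> // r s; first exact: (rmorphM (real_complex R)).
by congr Quaternion; ring.
Qed.

HB.instance Definition _ :=
  GRing.isZmodMorphism.Build R K (@ofreal R k) ofreal_is_additive.
HB.instance Definition _ :=
  GRing.isMonoidMorphism.Build R K (@ofreal R k) ofreal_is_monoid_morphism.

Fact sconj_is_additive : zmod_morphism (@sconj R k).
Proof.
case: k => //=; first by move=> x y; exact: rmorphB.
by case=> [a b c d] [a' b' c' d']; congr Quaternion => /=; ring.
Qed.

HB.instance Definition _ :=
  GRing.isZmodMorphism.Build K K (@sconj R k) sconj_is_additive.

Lemma sconjM x y : sconj (x * y) = sconj y * sconj x.
Proof.
case: k x y => /= x y; first exact: mulrC.
  by rewrite mulrC rmorphM.
by case: x y => [a b c d] [a' b' c' d']; congr Quaternion => /=; ring.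
Qed.

Lemma sconjK x : sconj (sconj x) = x.
Proof.
by case: k x => //= -[a b] => [|c d]; rewrite /= ?opprK.
Qed.

Lemma sconj_ofreal r : sconj (ofreal k r) = ofreal k r.
Proof. by case: k => //=; rewrite ?oppr0. Qed.

Lemma ofreal_comm r x : ofreal k r * x = x * ofreal k r.
Proof.
case: k x => /= x; [exact: mulrC | exact: mulrC |].
by case: x => a b c d; congr Quaternion => /=; ring.
Qed.

Lemma sconj_mul x : sconj x * x = ofreal k (sabs x ^+ 2).
Proof.
case: k x => /= x; first by rewrite real_normK ?num_real.
  case: x => a b /=; rewrite sqr_sqrtr ?addr_ge0 ?sqr_ge0 //.
  by apply/eqP; rewrite eq_complex /=; apply/andP; split; apply/eqP; ring.
case: x => a b c d /=; rewrite sqr_sqrtr ?addr_ge0 ?sqr_ge0 //.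
by congr Quaternion => /=; ring.
Qed.

Lemma sabs_ge0 x : 0 <= sabs x.
Proof. by case: k x => /= [x|[a b]|x]; rewrite ?normr_ge0 ?sqrtr_ge0. Qed.

Lemma sabs_ofreal r : sabs (ofreal k r) = `|r|.
Proof.
by case: k => //=; rewrite ?expr0n /= ?addr0 sqrtr_sqr.
Qed.

Lemma carrier_unit x : x != 0 -> x \is a GRing.unit.
Proof.
case: k x => /= x x0; [by rewrite unitfE | by rewrite unitfE | by []].
Qed.

Lemma sabs_eq0 x : (sabs x == 0) = (x == 0).
Proof.
apply/eqP/eqP => [x0|->]; last first.
  by rewrite -(rmorph0 (@ofreal R k)) sabs_ofreal normr0.
have [//|/carrier_unit ux] := eqVneq x 0.
have := sconj_mul x; rewrite x0 expr0n rmorph0 => /(canRL (mulrK ux)).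
by rewrite mul0r => /(congr1 (@sconj R k)); rewrite sconjK raddf0.
Qed.

Lemma sabs_gt0 x : (0 < sabs x) = (x != 0).
Proof. by rewrite lt_neqAle eq_sym sabs_ge0 sabs_eq0 andbT. Qed.

(** In y^* x^* x y the inner product x^* x is real, hence central, and can be moved out. *)
Lemma sabsM x y : sabs (x * y) = sabs x * sabs y.
Proof.
apply/eqP; rewrite -(eqrXn2 (n := 2)) ?mulr_ge0 ?sabs_ge0 //; apply/eqP.
apply: (fmorph_inj (@ofreal R k)).
rewrite /= -sconj_mul sconjM -mulrA (mulrA _ x) sconj_mul ofreal_comm mulrA.
by rewrite sconj_mul -rmorphM mulrC exprMn.
Qed.

End Scalars.

(** * Existence of the Moore-Penrose pseudoinverse *)

Section ConjTranspose.
Variables (R : realType) (k : scalars).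
Local Notation K := (carrier R k).

Lemma ofreal_scale_comm m n p (r : R) (A : 'M[K]_(m, n)) (B : 'M[K]_(n, p)) :
  A *m (ofreal k r *: B) = ofreal k r *: (A *m B).
Proof.
apply/matrixP => i j; rewrite !mxE mulr_sumr; apply: eq_bigr => l _.
by rewrite !mxE !mulrA ofreal_comm.
Qed.

Lemma conjTK m n (A : 'M[K]_(m, n)) : conjT (conjT A) = A.
Proof. by apply/matrixP => i j; rewrite !mxE sconjK. Qed.

Lemma conjTB m n (A B : 'M[K]_(m, n)) : conjT (A - B) = conjT A - conjT B.
Proof. by apply/matrixP => i j; rewrite !mxE raddfB. Qed.

Lemma conjTD m n (A B : 'M[K]_(m, n)) : conjT (A + B) = conjT A + conjT B.
Proof. by apply/matrixP => i j; rewrite !mxE raddfD. Qed.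

Lemma conjT0 m n : conjT (0 : 'M[K]_(m, n)) = 0.
Proof. by apply/matrixP => i j; rewrite !mxE raddf0. Qed.

Lemma conjT1 n : conjT (1%:M : 'M[K]_n) = 1%:M.
Proof.
apply/matrixP => i j; rewrite !mxE eq_sym; case: (i == j); last exact: raddf0.
by rewrite /= -(rmorph1 (@ofreal R k)) sconj_ofreal.
Qed.

Lemma conjT_scale m n r (A : 'M[K]_(m, n)) :
  conjT (ofreal k r *: A) = ofreal k r *: conjT A.
Proof.
by apply/matrixP => i j; rewrite !mxE sconjM sconj_ofreal ofreal_comm.
Qed.

Lemma conjT_block m1 m2 n1 n2 (A : 'M[K]_(m1, n1)) (B : 'M[K]_(m1, n2))
    (C : 'M[K]_(m2, n1)) (D : 'M[K]_(m2, n2)) :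
  conjT (block_mx A B C D) =
  block_mx (conjT A) (conjT C) (conjT B) (conjT D).
Proof. by rewrite /conjT tr_block_mx map_block_mx. Qed.

Lemma conjT_mul_col m (c : 'cV[K]_m) :
  exists2 r : R, conjT c *m c = ofreal k r *: 1%:M & 0 <= r ?= iff (c == 0).
Proof.
exists (\sum_i sabs (c i 0) ^+ 2).
  apply/matrixP => i j; rewrite !ord1 !mxE mulr1 rmorph_sum.
  by apply: eq_bigr => l _; rewrite !mxE sconj_mul.
split; first by apply: sumr_ge0 => i _; exact: sqr_ge0.
rewrite eq_sym psumr_eq0 => [|i _]; last exact: sqr_ge0.
apply/allP/eqP => [c0|-> i _]; last first.
  by rewrite /= mxE sqrf_eq0 sabs_eq0 eqxx.
apply/colP => i; rewrite mxE; apply/eqP.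
by have := c0 i (mem_index_enum _); rewrite sqrf_eq0 sabs_eq0.
Qed.

(* Greville's recursion: adjoin one column [a] to [B], and split according to *)
(* whether [a] lies in the column space of [B].                               *)
Lemma is_pinv_row m n (a : 'cV[K]_m) (B : 'M[K]_(m, n)) (Y : 'M[K]_(n, m)) :
  is_pinv B Y -> exists X, is_pinv (row_mx a B) X.
Proof.
case=> [BYB YBY BYh YBh]; pose d := Y *m a; pose c := a - B *m d.
have ac : a = B *m d + c by rewrite addrC subrK.
have YBd : Y *m B *m d = d by rewrite /d mulmxA YBY.
have Yc : Y *m c = 0 by rewrite mulmxBr mulmxA YBd subrr.
have cB : conjT c *m B = 0.
  by rewrite -BYB mulmxA -{1}BYh -conjTM -mulmxA Yc mulmx0 conjT0 mul0mx.
have [r cc [r0 rE]] := conjT_mul_col c.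
have [s dd [s0 _]] := conjT_mul_col d.
have [c0|cN0] := eqVneq c 0.
  (* Here a = B d. The new row is b = (1 + d^* d)^-1 d^* Y, which makes the corner of X A
     Hermitian. *)
  have s1 : 1 + s != 0 by rewrite gt_eqF // ltr_pwDl.
  pose t := ofreal k (1 + s)^-1; pose b := t *: (conjT d *m Y).
  have ts : t * ofreal k s = 1 - t.
    apply/eqP; rewrite eq_sym subr_eq -[X in _ + X]mulr1 -mulrDr addrC.
    by rewrite -(rmorph1 (@ofreal R k)) -rmorphD -rmorphM mulVf.
  have dYB : conjT d *m (Y *m B) = conjT d.
    by rewrite -YBh -conjTM YBd.
  have bB : b *m B = t *: conjT d by rewrite -scalemxAl -mulmxA dYB.
  have ba : b *m a = 1%:M - t%:M.
    by rewrite -scalemxAl -mulmxA -/d dd scalerA ts scalerBl scale1r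
      scale_scalar_mx mulr1.
  have bBY : b *m (B *m Y) = b by rewrite -scalemxAl -mulmxA (mulmxA Y) YBY.
  rewrite c0 addr0 in ac.
  exists (col_mx b (Y - d *m b)).
  have AX : row_mx a B *m col_mx b (Y - d *m b) = B *m Y.
    by rewrite mul_row_col mulmxBr mulmxA -ac addrC subrK.
  split; rewrite ?AX //.
  - by rewrite mul_mx_row BYB {1}ac mulmxA BYB -ac.
  - by rewrite -mulmxA AX mul_col_mx bBY mulmxBl mulmxA YBY -mulmxA bBY.
  have da : (Y - d *m b) *m a = t *: d.
    rewrite mulmxBl -mulmxA ba -/d mulmxBr mulmx1 opprB addrC subrK.
    by rewrite -(scalemx1 _ t) ofreal_scale_comm mulmx1.
  have dB : (Y - d *m b) *m B = Y *m B - t *: (d *m conjT d).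
    by rewrite mulmxBl -mulmxA bB ofreal_scale_comm.
  rewrite mul_col_row conjT_block bB ba da dB.
  congr block_mx; rewrite ?conjT_scale ?conjTK //.
    by rewrite conjTB conjT1 -(scalemx1 _ t) conjT_scale conjT1.
  by rewrite conjTB YBh conjT_scale conjTM conjTK.
have r_neq0 : r != 0 by rewrite eq_sym rE.
(* Here the new row is the pseudoinverse of the nonzero column [c]; it kills B and sends [a] to
   1. *)
pose b := ofreal k r^-1 *: conjT c.
have bc : b *m c = 1%:M.
  by rewrite -scalemxAl cc scalerA -rmorphM mulVf // rmorph1 scale1r.
have bB : b *m B = 0 by rewrite -scalemxAl cB scaler0.
have ba : b *m a = 1%:M by rewrite ac mulmxDr mulmxA bB mul0mx add0r bc.
exists (col_mx b (Y - d *m b)).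
have AX : row_mx a B *m col_mx b (Y - d *m b) = B *m Y + c *m b.
  by rewrite mul_row_col mulmxBr mulmxA {1}ac mulmxDl addrC addrA subrK.
have dB : (Y - d *m b) *m B = Y *m B by rewrite mulmxBl -mulmxA bB mulmx0 subr0.
have da : (Y - d *m b) *m a = 0 by rewrite mulmxBl -mulmxA ba mulmx1 subrr.
have XA : col_mx b (Y - d *m b) *m row_mx a B = block_mx 1%:M 0 0 (Y *m B).
  by rewrite mul_col_row ba bB da dB.
split; rewrite ?AX ?XA.
- rewrite mul_mx_row !(mulmxDl (B *m Y)) BYB -!(mulmxA c) ba bB.
  rewrite mulmx1 mulmx0 addr0.
  by rewrite -mulmxA -/d -ac.
- by rewrite mul_block_col !mul1mx !mul0mx addr0 add0r mulmxBr YBY mulmxA YBd.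
- by rewrite conjTD BYh ofreal_scale_comm conjT_scale conjTM conjTK.
- by rewrite conjT_block conjT1 !conjT0 YBh.
Qed.

Lemma is_pinv_exists m n (A : 'M[K]_(m, n)) : exists X, is_pinv A X.
Proof.
elim: n A => [|n IHn] A.
  exists 0; split; rewrite ?mulmx0 ?mul0mx ?conjT0 //.
  by apply/matrixP => i [].
have [Y] := IHn (rsubmx (A : 'M_(m, 1 + n))).
move/(is_pinv_row (lsubmx (A : 'M_(m, 1 + n)))).
by rewrite hsubmxK.
Qed.

Lemma pinvP m n (A : 'M[K]_(m, n)) : is_pinv A (pinv A).
Proof. by have [X AX] := is_pinv_exists A; rewrite (pinvE AX). Qed.

End ConjTranspose.

(** * Balancing logarithms on a support pattern *)

Section Balance.
Variable R : realType.

(* The least-squares residual [l + M z] is orthogonal to the columns of [M]   *)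
(* for [z = - M^+ l].                                                         *)
Lemma normal_equations m n (M : 'M[R]_(m, n)) (l : 'cV[R]_m) :
  exists z : 'cV[R]_n, M^T *m (l + M *m z) = 0.
Proof.
have [MXM _ MXh _] := @pinvP R Reals _ _ M.
exists (- (pinv (k := Reals) M *m l)).
have trE p q (A : 'M[R]_(p, q)) : conjT (k := Reals) A = A^T.
  by apply/matrixP => i j; rewrite !mxE.
(* Since M X is symmetric, transposing M X M = M gives M^T M X = M^T. *)
have := congr1 trmx MXM; rewrite trmx_mul -[(_ *m _)^T]trE MXh => MtMX.
by rewrite mulmxN mulmxDr mulmxN (mulmxA M) (mulmxA M^T) MtMX subrr.
Qed.

Lemma normal_equations_fin (I J : finType) (M : J -> I -> R) (l : J -> R) :
  exists z : I -> R,
    forall i, \sum_j M j i * (l j + \sum_i' M j i' * z i') = 0.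
Proof.
pose A : 'M[R]_(#|J|, #|I|) := \matrix_(j, i) M (enum_val j) (enum_val i).
have [w Aw] := normal_equations A (\col_j l (enum_val j)).
exists (fun i => w (enum_rank i) 0) => i.
have := congr1 (fun B : 'cV_#|I| => B (enum_rank i) 0) Aw.
rewrite !mxE => Awi; rewrite -[RHS]Awi big_enum_val /=.
apply: eq_bigr => j _; rewrite !mxE enum_rankK; congr (_ * (_ + _)).
rewrite big_enum_val /=; apply: eq_bigr => i' _.
by rewrite !mxE enum_valK.
Qed.

Variables I J : finType.
Implicit Types (S : I -> J -> bool) (L : I -> J -> R) (a : I -> R) (b : J -> R).

(** With L the logarithms of the absolute values and S the support, this says that the nonzero
    scaled absolute values have product 1 in every row and column. *)
Definition balanced S L a b :=
  (forall i, \sum_(j | S i j) (L i j + a i + b j) = 0) /\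
  (forall j, \sum_(i | S i j) (L i j + a i + b j) = 0).

Lemma balanced_exists S L : exists ab, balanced S L ab.1 ab.2.
Proof.
(* The edge-vertex incidence matrix of the bipartite graph S, with zero rows for non-edges. M^T sums
   residuals over the edges at a vertex, so the normal equations are the balance conditions. *)
pose M (p : I * J) (x : I + J) : R :=
  match x with
  | inl i => if S p.1 p.2 && (p.1 == i) then 1 else 0
  | inr j => if S p.1 p.2 && (p.2 == j) then 1 else 0
  end.
have [z zP] := normal_equations_fin M (fun p => L p.1 p.2).
have ME p : S p.1 p.2 -> \sum_x M p x * z x = z (inl p.1) + z (inr p.2).
  move=> Sp; rewrite big_sumType /= Sp /=; congr (_ + _).
    rewrite (bigD1 p.1) //= eqxx mul1r big1 ?addr0 // => i.
    by rewrite eq_sym => /negPf ->; rewrite mul0r.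
  rewrite (bigD1 p.2) //= eqxx mul1r big1 ?addr0 // => i.
  by rewrite eq_sym => /negPf ->; rewrite mul0r.
exists (z \o inl, z \o inr); split=> [i|j] /=.
  rewrite -[RHS](zP (inl i)) /= -(pair_bigA _ (fun i' j =>
    (if S i' j && (i' == i) then 1 else 0) *
    (L i' j + \sum_x M (i', j) x * z x))) /=.
  rewrite (bigD1 i) //= [X in _ = _ + X]big1 ?addr0 => [|i' /negPf ne];
    last first.
    by apply: big1 => j _; rewrite ne andbF mul0r.
  rewrite big_mkcond; apply: eq_bigr => j _; rewrite eqxx andbT.
  by case: ifP => [Sij|]; rewrite ?mul0r // mul1r ME //= addrA.
rewrite -[RHS](zP (inr j)) /= -(pair_bigA _ (fun i j' =>
  (if S i j' && (j' == j) then 1 else 0) *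
  (L i j' + \sum_x M (i, j') x * z x))) /=.
rewrite exchange_big (bigD1 j) //=.
rewrite [X in _ = _ + X]big1 ?addr0 => [|j' /negPf ne]; last first.
  by apply: big1 => i _; rewrite ne andbF mul0r.
rewrite big_mkcond; apply: eq_bigr => i _; rewrite eqxx andbT.
by case: ifP => [Sij|]; rewrite ?mul0r // mul1r ME //= addrA.
Qed.

Lemma balanced_unique S L a b a' b' i j :
  balanced S L a b -> balanced S L a' b' -> S i j -> a i + b j = a' i + b' j.
Proof.
move=> [rab cab] [rab' cab'].
pose h i j := (a i - a' i) + (b j - b' j).
have hE i' j' : h i' j' = (L i' j' + a i' + b j') - (L i' j' + a' i' + b' j').
  by rewrite /h; ring.
have rh i' : \sum_(j' | S i' j') h i' j' = 0.
  by under eq_bigr do rewrite hE; rewrite sumrB rab rab' subrr.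
have ch j' : \sum_(i' | S i' j') h i' j' = 0.
  by under eq_bigr do rewrite hE; rewrite sumrB cab cab' subrr.
(* [h] is orthogonal to every function [u i + v j], in particular to itself. *)
have hh : \sum_i' \sum_(j' | S i' j') h i' j' ^+ 2 = 0.
  under eq_bigr do under eq_bigr do rewrite expr2 {1}/h mulrDl.
  under eq_bigr do rewrite big_split /= -mulr_sumr rh mulr0 add0r.
  rewrite (exchange_big_dep predT) //= big1 // => j' _.
  by rewrite -mulr_sumr ch mulr0.
have h2 i' : 0 <= \sum_(j' | S i' j') h i' j' ^+ 2.
  by apply: sumr_ge0 => j' _; exact: sqr_ge0.
move/eqP: hh; rewrite psumr_eq0 // => /allP /(_ i (mem_index_enum _)) /=.
rewrite psumr_eq0 => [|j' _]; last exact: sqr_ge0.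
move=> /allP /(_ j (mem_index_enum _)) /implyP hij /hij.
by rewrite sqrf_eq0 /h addrACA -opprD subr_eq0 => /eqP.
Qed.

End Balance.

(** * Column rank over a division ring *)

Section ColumnRank.
Variable K : unitRingType.
Hypothesis Kdiv : forall x : K, x != 0 -> x \is a GRing.unit.

(** Gaussian elimination on the first row, keeping coefficients on the right of the columns. *)
Lemma wide_kernel t s (W : 'M[K]_(t, s)) :
  (t < s)%N -> exists2 v : 'cV[K]_s, v != 0 & W *m v = 0.
Proof.
elim: t s W => [|t IHt] [//|s] W ts.
  exists (const_mx 1); last by apply/matrixP => -[].
  by apply/eqP => /matrixP /(_ 0 0) /eqP; rewrite !mxE oner_eq0.
pose T := dsubmx (W : 'M_(1 + t, s.+1)).
pose w := usubmx (W : 'M_(1 + t, s.+1)).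
have WE v : w *m v = 0 -> T *m v = 0 -> W *m v = 0.
  move=> wv Tv; have -> : W *m v = col_mx (w *m v) (T *m v).
    by rewrite -mul_col_mx vsubmxK.
  by rewrite wv Tv col_mx0.
have [w0|] := eqVneq w 0.
  have [v v0 Tv] := IHt _ T (ltnW ts).
  by exists v => //; apply: WE => //; rewrite w0 mul0mx.
move=> /eqP wN0; have [j wj] : exists j, w 0 j != 0.
  apply/existsP/contraT; rewrite negb_exists => /forallP w0; case: wN0.
  by apply/rowP => j; rewrite [RHS]mxE; apply/eqP; move/negbNE: (w0 j).
(* The Schur complement of the pivot [w 0 j]; below, [x] solves the first equation for the pivot
   coordinate. *)
pose V : 'M[K]_(t, s) :=
  \matrix_(i, l) (T i (lift j l) - T i j * (w 0 j)^-1 * w 0 (lift j l)).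
have [u u0 Vu] := IHt _ V ts.
pose x := - (w 0 j)^-1 * \sum_l w 0 (lift j l) * u l 0.
pose v : 'cV[K]_s.+1 := \col_l oapp (fun l' => u l' 0) x (unlift j l).
have mulv p (A : 'M[K]_(p, s.+1)) i :
    (A *m v) i 0 = A i j * x + \sum_l A i (lift j l) * u l 0.
  rewrite mxE (bigD1_ord j) //= mxE unlift_none; congr (_ + _).
  by apply: eq_bigr => l _; rewrite mxE liftK.
exists v.
  apply: contraNneq u0 => /colP v0; apply/eqP/colP => l.
  by have := v0 (lift j l); rewrite !mxE liftK.
apply: WE; apply/colP => i; rewrite mulv [RHS]mxE.
  by rewrite ord1 /x mulrA mulrN divrr ?Kdiv // mulN1r addNr.
have := congr1 (fun B : 'cV_t => B i 0) Vu; rewrite !mxE => Vui.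
rewrite -[RHS]Vui /x mulrA mulrN mulNr mulr_sumr -sumrN -big_split /=.
by apply: eq_bigr => l _; rewrite !mxE mulrBl !mulrA addrC.
Qed.

(** B is a maximal right-independent set of columns; C holds the coordinates of all columns in
    it. *)
Lemma col_rank_basis m n (X : 'M[K]_(m, n)) :
  exists (B : {set 'I_n}) (C : 'M[K]_n),
    [/\ (#|B| <= col_rank X)%N, X = X *m C &
        forall i j, i \notin B -> C i j = 0].
Proof.
have X0 : `[< col_indep X finset.set0 >].
  by apply/asboolP => v v0 _; apply/colP => j; rewrite mxE v0 ?inE.
pose free (B : {set 'I_n}) := `[< col_indep X B >].
case: (@arg_maxnP _ _ free (fun B => #|B|) X0) => B BX Bmax.
have /asboolP Bfree := BX.
suff /choice[c cP] : forall l, exists c : 'cV[K]_n,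
    col l X = X *m c /\ forall i, i \notin B -> c i 0 = 0.
  exists B, (\matrix_(i, j) c j i 0); split.
  - exact: (leq_bigmax_cond (F := fun B : {set 'I_n} => #|B|)).
  - apply/matrixP => i j; have /colP/(_ i) := (cP j).1; rewrite !mxE => ->.
    by apply: eq_bigr => l _; rewrite mxE.
  - by move=> i j iB; rewrite mxE (cP j).2.
move=> l; have [lB|lB] := boolP (l \in B).
  exists (delta_mx l 0); split; first by rewrite colE.
  by move=> i iB; rewrite mxE; case: eqP => // il; rewrite il lB in iB.
have : ~ col_indep X (l |: B).
  by move=> /asboolP /Bmax; rewrite /= cardsU1 lB ltnn.
move=> /existsNP[v /not_implyP[v0 /not_implyP[Xv /eqP vN0]]].
have vl : v l 0 != 0.
  apply: contraNneq vN0 => vl0; apply/eqP; apply: Bfree => // j jB.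
  by have [->//|jl] := eqVneq j l; rewrite v0 // !inE negb_or jl.
pose e : 'cV[K]_n := delta_mx l 0.
pose d : 'M[K]_1 := (v l 0)^-1%:M.
(* The dependency [v] is rescaled on the right to have coefficient 1 at [l], then solved for column
   [l]. *)
exists (e - v *m d); split.
  by rewrite mulmxBr mulmxA Xv mul0mx subr0 colE.
move=> i iB; rewrite !mxE big_ord1 !mxE eqxx mulr1n andbT.
have [->|il] := eqVneq i l; first by rewrite divrr ?Kdiv // subrr.
have iJ : i \notin l |: B by rewrite !inE negb_or il.
by rewrite (v0 _ iJ) mul0r subr0.
Qed.

Lemma col_rank_mul_leq m n p (X : 'M[K]_(m, n)) (A : 'M[K]_(n, p)) :
  (col_rank (X *m A) <= minn (col_rank X) (col_rank A))%N.
Proof.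
rewrite leq_min; apply/andP; split; apply/bigmax_leqP => J /asboolP Jfree;
  last first.
  apply: (leq_bigmax_cond (F := fun B : {set 'I_p} => #|B|)).
  by apply/asboolP => v v0 Av; apply: Jfree => //; rewrite -mulmxA Av mulmx0.
have [B [C [leB XC C0]]] := col_rank_basis X.
apply: leq_trans leB; rewrite leqNgt; apply/negP => ltBJ.
(* Only the rows of C A in B can be nonzero. More than #|B| columns of it are dependent, and X = X C
   carries the dependency to X A. *)
pose W := mxsub (@enum_val _ (mem B)) (@enum_val _ (mem J)) (C *m A).
have [v /eqP vN0 Wv] := wide_kernel W ltBJ; apply: vN0.
pose u : 'cV[K]_p := \col_j \sum_(l < #|J| | enum_val l == j) v l 0.
have uE l : u (enum_val l) 0 = v l 0.
  by rewrite mxE (big_pred1 l) // => l'; rewrite (inj_eq enum_val_inj).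
have u0 j : j \notin J -> u j 0 = 0.
  move=> jJ; rewrite mxE big1 // => l /eqP lj.
  by move: jJ; rewrite -lj enum_valP.
suff CAu : C *m A *m u = 0.
  have uu : u = 0.
    by apply: Jfree => //; rewrite XC -!mulmxA (mulmxA C) CAu mulmx0.
  by apply/colP => l; rewrite -uE uu !mxE.
apply/colP => i; rewrite [RHS]mxE; have [iB|iB] := boolP (i \in B); last first.
  by rewrite -mulmxA mxE big1 // => j _; rewrite C0 // mul0r.
rewrite -(enum_rankK_in iB iB); set i' := enum_rank_in iB i.
have := congr1 (fun M : 'cV_#|B| => M i' 0) Wv; rewrite [RHS]mxE => Wvi.
rewrite -[RHS]Wvi !mxE (bigID (mem J)) /= [X in _ + X]big1 ?addr0; last first.
  by move=> j jJ; rewrite u0 // mulr0.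
by rewrite big_enum_val; apply: eq_bigr => l _; rewrite uE [in RHS]mxE.
Qed.

Lemma col_rank_reflexive_ginv m n (A : 'M[K]_(m, n)) (X : 'M[K]_(n, m)) :
  A *m X *m A = A -> X *m A *m X = X -> col_rank X = col_rank A.
Proof.
move=> AXA XAX; apply/eqP; rewrite eqn_leq.
have := col_rank_mul_leq (X *m A) X; have := col_rank_mul_leq X A.
have := col_rank_mul_leq (A *m X) A; have := col_rank_mul_leq A X.
rewrite AXA XAX !leq_min => /andP[_ AX] /andP[A1 _] /andP[_ XA] /andP[X1 _].
by rewrite (leq_trans X1 XA) (leq_trans A1 AX).
Qed.

End ColumnRank.

(** * Pseudoinverses under two-sided multiplication *)

Section PinvSimilar.
Variables (R : realType) (k : scalars).
Local Notation K := (carrier R k).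

Lemma is_pinv_conjT m n (A : 'M[K]_(m, n)) (X : 'M[K]_(n, m)) :
  is_pinv A X -> is_pinv (conjT A) (conjT X).
Proof.
case=> AXA XAX AXh XAh; split; rewrite -?conjTM ?mulmxA ?AXA ?XAX ?conjTK //;
  by rewrite ?AXh ?XAh.
Qed.

(** N preserves the range of A, so P N P = N P for the projection P = A X; taking adjoints gives P N
    P = P N. *)
Lemma range_proj_comm m n (A : 'M[K]_(m, n)) (X : 'M[K]_(n, m)) N M :
  is_pinv A X -> conjT N = N -> N *m A = A *m M ->
  N *m (A *m X) = A *m X *m N.
Proof.
case=> AXA _ AXh _ Nh NA.
have PNP : A *m X *m N *m (A *m X) = N *m (A *m X).
  by rewrite -mulmxA (mulmxA N) NA !mulmxA AXA.
rewrite -[RHS]conjTK (conjTM (A *m X)) AXh Nh -PNP.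
by rewrite (conjTM (A *m X *m N)) (conjTM (A *m X)) Nh AXh !mulmxA.
Qed.

Lemma conjT_similar m (U U' P : 'M[K]_m) :
  is_inverse_mx U U' -> conjT P = P ->
  conjT U *m U *m P = P *m (conjT U *m U) ->
  conjT (U *m P *m U') = U *m P *m U'.
Proof.
move=> [UU' U'U] Ph NP.
have U'U_h : conjT U' *m conjT U = 1%:M by rewrite -conjTM UU' conjT1.
rewrite !conjTM Ph -[RHS]mul1mx -U'U_h -!mulmxA; congr (_ *m _).
by rewrite !mulmxA NP -!mulmxA UU' mulmx1.
Qed.

(** The first two Penrose equations follow by cancellation. The intertwining hypothesis makes U^* U
    commute with A X and, through its adjoint, V'^* V' with X A; this keeps both conjugated
    projections Hermitian. *)
Lemma is_pinv_similar m n (A : 'M[K]_(m, n)) X (U U' : 'M[K]_m)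
    (V V' : 'M[K]_n) :
  is_pinv A X -> is_inverse_mx U U' -> is_inverse_mx V V' ->
  conjT U *m U *m A = A *m (conjT V' *m V') ->
  is_pinv (U *m A *m V) (V' *m X *m U').
Proof.
move=> AX iU iV UAV; have [UU' U'U] := iU; have [VV' V'V] := iV.
have [AXA XAX AXh XAh] := AX.
have Nh p (W : 'M[K]_p) : conjT (conjT W *m W) = conjT W *m W.
  by rewrite conjTM conjTK.
have lE : U *m A *m V *m (V' *m X *m U') = U *m (A *m X) *m U'.
  by rewrite !mulmxA -(mulmxA (U *m A)) VV' mulmx1.
have rE : V' *m X *m U' *m (U *m A *m V) = V' *m (X *m A) *m V.
  by rewrite !mulmxA -(mulmxA (V' *m X)) U'U mulmx1.
split; rewrite ?lE ?rE.
- by rewrite !mulmxA -(mulmxA _ U') U'U mulmx1 -2!(mulmxA U) AXA.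
- by rewrite !mulmxA -(mulmxA _ V V') VV' mulmx1 -2!(mulmxA V') XAX.
- exact/conjT_similar/(range_proj_comm AX (Nh _ _) UAV).
apply: conjT_similar => //.
have := range_proj_comm (is_pinv_conjT AX) (Nh _ V') (M := conjT U *m U).
rewrite -conjTM XAh; apply.
by rewrite -[in LHS]Nh -conjTM -UAV conjTM Nh.
Qed.

End PinvSimilar.

(** * The scale functions, their axioms, and diagonal consistency *)

Lemma diag_mul_entry (K : pzSemiRingType) m n (x : 'rV[K]_m) (y : 'rV[K]_n)
    (A : 'M[K]_(m, n)) i j :
  (diag_mx x *m A *m diag_mx y) i j = x 0 i * A i j * y 0 j.
Proof. by rewrite mul_mx_diag mxE mul_diag_mx mxE. Qed.

Lemma is_inverse_mxM (K : nzRingType) n (D D' E E' : 'M[K]_n) :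
  is_inverse_mx D D' -> is_inverse_mx E E' ->
  is_inverse_mx (D *m E) (E' *m D').
Proof.
move=> [DD' D'D] [EE' E'E].
by split; rewrite mulmxA; [rewrite -(mulmxA D) EE' | rewrite -(mulmxA E') D'D];
  rewrite mulmx1.
Qed.

Lemma is_inverse_mx_sym (K : nzRingType) n (D D' : 'M[K]_n) :
  is_inverse_mx D D' -> is_inverse_mx D' D.
Proof. by case. Qed.

Section Scales.
Variables (R : realType) (k : scalars).
Local Notation K := (carrier R k).
Variables m n : nat.
Implicit Types (A : 'M[K]_(m, n)) (B : 'M[R]_(m, n)).

Lemma inverse_diagP p (d : 'rV[K]_p) (D' : 'M[K]_p) :
  is_inverse_mx (diag_mx d) D' ->
  exists2 d' : 'rV[K]_p, D' = diag_mx d' &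
    forall i, sabs (d' 0 i) * sabs (d 0 i) = 1.
Proof.
move=> [DD' D'D].
have du i : d 0 i \is a GRing.unit.
  apply: carrier_unit; apply/eqP => d0.
  have /matrixP/(_ i i)/eqP := DD'; rewrite mul_diag_mx !mxE d0 mul0r eqxx.
  by rewrite eq_sym oner_eq0.
exists (map_mx GRing.inv d) => [|i]; last first.
  by rewrite mxE -sabsM mulVr // -(rmorph1 (@ofreal R k)) sabs_ofreal normr1.
have DdV : diag_mx d *m diag_mx (map_mx GRing.inv d) = 1%:M.
  by apply/matrixP => i j; rewrite mul_diag_mx !mxE; case: eqP => [->|_];
    rewrite ?mulr0 // divrr.
by rewrite -[LHS]mulmx1 -DdV mulmxA D'D mul1mx.
Qed.

Definition abs_mx A : 'M[R]_(m, n) := map_mx (@sabs R k) A.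

(** The value of [ln] at a zero entry never enters, since the balance sums run over the support. *)
Definition log_scale B : ('I_m -> R) * ('I_n -> R) :=
  sval (cid (balanced_exists (fun i j => B i j != 0) (fun i j => ln (B i j)))).

Lemma log_scaleP B :
  balanced (fun i j => B i j != 0) (fun i j => ln (B i j))
    (log_scale B).1 (log_scale B).2.
Proof. exact: (svalP (cid (balanced_exists _ _))). Qed.

Definition scaleL A : 'M[R]_m :=
  diag_mx (\row_i expR ((log_scale (abs_mx A)).1 i)).

Definition scaleR A : 'M[R]_n :=
  diag_mx (\row_j expR ((log_scale (abs_mx A)).2 j)).

Definition weight A i j : R :=
  expR ((log_scale (abs_mx A)).1 i + (log_scale (abs_mx A)).2 j).

Lemma scaledE A i j :
  scaled scaleL scaleR A i j = ofreal k (weight A i j) * A i j.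
Proof.
rewrite /scaled /ofreal_mx !map_diag_mx diag_mul_entry !mxE -mulrA.
by rewrite -ofreal_comm mulrA -rmorphM -expRD.
Qed.

(** Pulling the log scales of A' back along [s], [t] and adding [ln d], [ln e] balances A, so
    uniqueness applies. This one fact serves axioms (i), (ii) and statement 3. *)
Lemma weight_rescale A A' (s : 'S_m) (t : 'S_n)
    (d : 'I_m -> R) (e : 'I_n -> R) :
  (forall i, 0 < d i) -> (forall j, 0 < e j) ->
  (forall i j, sabs (A' (s i) (t j)) = d i * sabs (A i j) * e j) ->
  forall i j, A i j != 0 -> weight A' (s i) (t j) * (d i * e j) = weight A i j.
Proof.
move=> d0 e0 AA' i j Aij; rewrite /weight.
case: (log_scale _) (log_scaleP (abs_mx A)) => a b /= bal.
case: (log_scale _) (log_scaleP (abs_mx A')) => a' b' /= bal'.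
have bal'A : balanced (fun i j => abs_mx A i j != 0)
    (fun i j => ln (abs_mx A i j))
    (fun i => a' (s i) + ln (d i)) (fun j => b' (t j) + ln (e j)).
  have supp i' j' : (abs_mx A i' j' != 0) = (abs_mx A' (s i') (t j') != 0).
    by rewrite !mxE AA' !mulf_eq0 (gt_eqF (d0 _)) (gt_eqF (e0 _)) orbF.
  have term i' j' : abs_mx A i' j' != 0 ->
      ln (abs_mx A i' j') + (a' (s i') + ln (d i')) + (b' (t j') + ln (e j'))
      = ln (abs_mx A' (s i') (t j')) + a' (s i') + b' (t j').
    rewrite !mxE AA' sabs_eq0 => Aij'.
    have A0 : 0 < sabs (A i' j') by rewrite sabs_gt0.
    by rewrite !lnM ?posrE ?mulr_gt0 //; ring.
  split=> [i'|j'].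
    rewrite -[RHS](bal'.1 (s i')) [RHS](reindex_inj (@perm_inj _ t)) /=.
    by apply: eq_big => [j'|j' ?]; [exact: supp | exact: term].
  rewrite -[RHS](bal'.2 (t j')) [RHS](reindex_inj (@perm_inj _ s)) /=.
  by apply: eq_big => [i'|i' ?]; [exact: supp | exact: term].
have Bij : abs_mx A i j != 0 by rewrite mxE sabs_eq0.
rewrite (balanced_unique bal bal'A Bij) addrACA [in RHS]expRD.
by rewrite [expR (ln _ + _)]expRD !lnK ?posrE.
Qed.

Lemma weight_diag A (d : 'rV[K]_m) (e : 'rV[K]_n) :
  (forall i, d 0 i != 0) -> (forall j, e 0 j != 0) ->
  forall i j, A i j != 0 ->
  weight (diag_mx d *m A *m diag_mx e) i j * (sabs (d 0 i) * sabs (e 0 j)) =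
  weight A i j.
Proof.
move=> d0 e0 i j Aij.
rewrite -(weight_rescale (A' := diag_mx d *m A *m diag_mx e) (s := 1) (t := 1)
  (d := fun i => sabs (d 0 i)) (e := fun j => sabs (e 0 j)) _ _ _ Aij)
  ?perm1 // => [i'|j'|i' j']; rewrite ?sabs_gt0 //.
by rewrite !perm1 diag_mul_entry !sabsM.
Qed.

Lemma is_pos_diagP p (D : 'M[R]_p) : is_pos_diag D ->
  exists2 d : 'rV[R]_p, ofreal_mx k D = diag_mx (map_mx (@ofreal R k) d) &
    forall i, 0 < d 0 i.
Proof.
case=> /diag_mxP[d ->] d0; exists d; first by rewrite /ofreal_mx map_diag_mx.
by move=> i; have := d0 i; rewrite mxE eqxx mulr1n.
Qed.

Lemma is_pos_diag_expR p (f : 'I_p -> R) :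
  is_pos_diag (diag_mx (\row_i expR (f i))).
Proof.
split=> [|i]; first exact: diag_mx_is_diag.
by rewrite !mxE eqxx mulr1n expR_gt0.
Qed.

Lemma abs_mx_unitary A (Du : 'M[K]_m) (Dv : 'M[K]_n) :
  is_unitary_diag Du -> is_unitary_diag Dv -> abs_mx (Du *m A *m Dv) = abs_mx A.
Proof.
move=> [/diag_mxP[d ->] d1] [/diag_mxP[e ->] e1]; apply/matrixP => i j.
rewrite [LHS]mxE [RHS]mxE diag_mul_entry !sabsM.
have := d1 i; have := e1 j; rewrite !mxE !eqxx !mulr1n => -> ->.
by rewrite mul1r mulr1.
Qed.

Lemma scale_general_diagonal : general_diagonal_scale scaleL scaleR.
Proof.
split=> [A|A|A Dp Ep|A s t|A Du Dv uDu uDv|A Du Dv uDu uDv].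
- exact: is_pos_diag_expR.
- exact: is_pos_diag_expR.
- move=> /is_pos_diagP[d -> d0] /is_pos_diagP[e -> e0].
  apply/matrixP => i j; rewrite !scaledE diag_mul_entry.
  (* Off the support the weights are not determined, but both sides vanish. *)
  have [->|Aij] := eqVneq (A i j) 0; first by rewrite !(mulr0, mul0r).
  rewrite -(@weight_diag A (map_mx (@ofreal R k) d)
    (map_mx (@ofreal R k) e)) //.
  + rewrite !mxE !sabs_ofreal !gtr0_norm // !rmorphM -!mulrA.
    congr (_ * (_ * _)); by rewrite ofreal_comm.
  + by move=> i'; rewrite mxE fmorph_eq0 gt_eqF.
  by move=> j'; rewrite mxE fmorph_eq0 gt_eqF.
- have permE (M : 'M[K]_(m, n)) i j :
      (perm_mx s *m M *m perm_mx t) i j = M (s i) ((t^-1)%g j).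
    by rewrite -row_permE -[t]invgK -col_permE !mxE invgK.
  apply/matrixP => i j; rewrite permE !scaledE permE.
  have [->|Aij] := eqVneq (A (s i) ((t^-1)%g j)) 0; first by rewrite !mulr0.
  congr (ofreal k _ * _).
  (* By [permE], entry (p, q) of A moves to (s^-1 p, t q), hence the inverse of [s] only. *)
  rewrite -(weight_rescale (A' := perm_mx s *m A *m perm_mx t)
    (s := (s^-1)%g) (t := t) (d := fun=> 1) (e := fun=> 1) _ _ _ Aij) //.
    by rewrite permK permKV !mulr1.
  by move=> i' j'; rewrite permE permKV permK mul1r mulr1.
- by rewrite /scaleL abs_mx_unitary.
by rewrite /scaleR abs_mx_unitary.
Qed.

Lemma ofreal_diag_inverse p (f : 'I_p -> R) :
  is_inverse_mx (ofreal_mx k (diag_mx (\row_i expR (f i))))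
    (ofreal_mx k (diag_mx (\row_i expR (- f i)))).
Proof.
have expNE g g' : (forall i, g i + g' i = 0 :> R) ->
    ofreal_mx k (diag_mx (\row_i expR (g i))) *m
    ofreal_mx k (diag_mx (\row_(i < p) expR (g' i))) = 1%:M.
  move=> gg'; rewrite -map_mxM mulmx_diag -[RHS](map_mx1 (@ofreal R k)).
  congr map_mx; apply/matrixP => i j; rewrite !mxE -expRD gg' expR0.
  by case: eqP.
by split; apply: expNE => i; rewrite ?subrr ?addNr.
Qed.

Lemma Uinv_ginverse A :
  let Y := Uinv scaleL scaleR A in A *m Y *m A = A /\ Y *m A *m Y = Y.
Proof.
rewrite /Uinv /=.
set P := ofreal_mx k (scaleL A); set Q := ofreal_mx k (scaleR A).
have [Pi [PPi PiP]] : exists Pi, is_inverse_mx P Pi.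
  by eexists; exact: ofreal_diag_inverse.
have [Qi [QQi QiQ]] : exists Qi, is_inverse_mx Q Qi.
  by eexists; exact: ofreal_diag_inverse.
set X := pinv _; have [SXS XSX _ _] := pinvP (scaled scaleL scaleR A).
rewrite -/X /scaled -/P -/Q in SXS XSX; split.
  have := congr1 (fun M => Pi *m M *m Qi) SXS.
  rewrite !mulmxA PiP !mul1mx -[in LHS]mulmxA QQi mulmx1 => SE.
  by rewrite -!(mulmxA _ Q Qi) QQi !mulmx1 in SE.
by rewrite -[in RHS]XSX !mulmxA.
Qed.

Lemma conjT_diag_mul p (u : 'rV[K]_p) :
  conjT (diag_mx u) *m diag_mx u =
  diag_mx (\row_i ofreal k (sabs (u 0 i) ^+ 2)).
Proof.
apply/matrixP => i j; rewrite mul_mx_diag !mxE eq_sym.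
by case: eqP => [->|_]; rewrite ?mulr1n ?mulr0n ?raddf0 ?mul0r // sconj_mul.
Qed.

Lemma expR_diag_mul p (f g : 'I_p -> R) (x : 'rV[K]_p) :
  ofreal_mx k (diag_mx (\row_i expR (f i))) *m diag_mx x *m
    ofreal_mx k (diag_mx (\row_i expR (g i))) =
  diag_mx (\row_i (ofreal k (expR (f i)) * x 0 i * ofreal k (expR (g i)))).
Proof.
rewrite /ofreal_mx !map_diag_mx !mulmx_diag; congr diag_mx.
by apply/rowP => i; rewrite !mxE.
Qed.

Lemma Uinv_diag A (D D' : 'M[K]_m) (E E' : 'M[K]_n) :
  is_diag_mx D -> is_inverse_mx D D' -> is_diag_mx E -> is_inverse_mx E E' ->
  Uinv scaleL scaleR (D *m A *m E) = E' *m Uinv scaleL scaleR A *m D'.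
Proof.
move=> /diag_mxP[d ->] iD /diag_mxP[e ->] iE.
have [d' D'E dd'] := inverse_diagP iD; have [e' E'E ee'] := inverse_diagP iE.
have d_neq0 i : sabs (d 0 i) != 0.
  by apply: contraTneq (oner_neq0 R) => di0; rewrite -(dd' i) di0 mulr0 eqxx.
have e_neq0 j : sabs (e 0 j) != 0.
  by apply: contraTneq (oner_neq0 R) => ej0; rewrite -(ee' j) ej0 mulr0 eqxx.
set A' := _ *m A *m _.
have wE i j : A i j != 0 ->
    weight A' i j * (sabs (d 0 i) * sabs (e 0 j)) = weight A i j.
  by apply: weight_diag => l; rewrite -sabs_eq0.
pose a := (log_scale (abs_mx A)).1; pose b := (log_scale (abs_mx A)).2.
pose a' := (log_scale (abs_mx A')).1; pose b' := (log_scale (abs_mx A')).2.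
have iP := ofreal_diag_inverse a; have iP' := ofreal_diag_inverse a'.
have iQ := ofreal_diag_inverse b; have iQ' := ofreal_diag_inverse b'.
set P := ofreal_mx k _ in iP; set P' := ofreal_mx k _ in iP'.
set Q := ofreal_mx k _ in iQ; set Q' := ofreal_mx k _ in iQ'.
set Pi := ofreal_mx k _ in iP; set P'i := ofreal_mx k _ in iP'.
set Qi := ofreal_mx k _ in iQ; set Q'i := ofreal_mx k _ in iQ'.
have iU := is_inverse_mxM (is_inverse_mxM iP' iD) (is_inverse_mx_sym iP).
have iV := is_inverse_mxM (is_inverse_mxM (is_inverse_mx_sym iQ) iE) iQ'.
pose S := scaled scaleL scaleR A.
(* With U = P' D P^-1 and V = Q^-1 E Q', the scaled form of A' is U S V. Entrywise the claim is
   |u_i|^2 S_ij = S_ij |v_j|^-2, that is |u_i| |v_j| = 1 on the support, which is [wE]. *)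
have UV : conjT (P' *m diag_mx d *m Pi) *m (P' *m diag_mx d *m Pi) *m S =
    S *m (conjT (Q'i *m (E' *m Q)) *m (Q'i *m (E' *m Q))).
  rewrite (mulmxA Q'i) E'E !expR_diag_mul !conjT_diag_mul.
  apply/matrixP => i j; rewrite mul_diag_mx mul_mx_diag.
  rewrite [LHS]mxE [RHS]mxE scaledE !mxE.
  have [->|Aij] := eqVneq (A i j) 0; first by rewrite !(mulr0, mul0r).
  rewrite -[RHS]ofreal_comm; congr (ofreal k (_ ^+ 2) * _).
  rewrite !sabsM !sabs_ofreal !gtr0_norm ?expR_gt0 // !expRN.
  rewrite -[sabs (e' 0 j)](mulfK (e_neq0 j)) ee' div1r.
  have expR_neq0 x : expR x != 0 :> R by rewrite gt_eqF ?expR_gt0.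
  have := wE i j Aij; rewrite /weight -/a -/b -/a' -/b' !expRD => w.
  transitivity (expR (a' i) * expR (b' j) * (sabs (d 0 i) * sabs (e 0 j)) /
      (expR (a i) * expR (b' j) * sabs (e 0 j))).
    by field; rewrite !expR_neq0 e_neq0.
  by rewrite w; field; rewrite !expR_neq0 e_neq0.
have := is_pinv_similar (pinvP S) iU iV UV.
have -> : P' *m diag_mx d *m Pi *m S *m (Qi *m diag_mx e *m Q') =
    scaled scaleL scaleR A'.
  rewrite /S /scaled -/P -/Q -/P' -/Q' !mulmxA -(mulmxA _ Pi) iP.2 mulmx1.
  by rewrite -(mulmxA _ Q) iQ.1 mulmx1.
move=> /pinvE; rewrite /Uinv -/P -/Q -/P' -/Q' => ->.
by rewrite !mulmxA iQ'.1 mul1mx -!mulmxA iP'.2 mulmx1.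
Qed.

End Scales.

Theorem mainTheorem1 (R : realType) (k : scalars) (m n : nat)
    (hm : (0 < m)%N) (hn : (0 < n)%N) :
  exists (DL : 'M[carrier R k]_(m, n) -> 'M[R]_m)
         (DR : 'M[carrier R k]_(m, n) -> 'M[R]_n),
    general_diagonal_scale DL DR /\
    forall A : 'M[carrier R k]_(m, n),
      [/\ A *m Uinv DL DR A *m A = A,
          Uinv DL DR A *m A *m Uinv DL DR A = Uinv DL DR A,
          (forall (D D' : 'M[carrier R k]_m) (E E' : 'M[carrier R k]_n),
             is_diag_mx D -> is_inverse_mx D D' ->
             is_diag_mx E -> is_inverse_mx E E' ->
             Uinv DL DR (D *m A *m E) = E' *m Uinv DL DR A *m D')
        & col_rank (Uinv DL DR A) = col_rank A].
Proof.
exists (@scaleL R k m n), (@scaleR R k m n).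
split; first exact: scale_general_diagonal.
move=> A; have [AYA YAY] := Uinv_ginverse A; split=> //.
  by move=> D D' E E'; exact: Uinv_diag.
exact: (col_rank_reflexive_ginv (@carrier_unit R k)).
Qed.
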